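(* For every positive integer $k$, every normal subspace of $\omega_1^k$ is semi-proximal.
   Context: $\omega_1$ carries the order topology, $\omega_1^k$ the product topology, and subsets the subspace topology. The proximal game on a uniform space $(X,\mathfrak U)$ (where $\mathfrak U$ is a uniformity or a base for a uniformity): in inning $0$, Player I chooses an entourage $U_0\in\mathfrak U$ and Player II chooses $x_0\in X$. In inning $n+1$, Player I chooses an entourage $U_{n+1}\in\mathfrak U$ with $U_{n+1}\subseteq U_n$ and Player II chooses $x_{n+1}\in U_n[x_n]=\{y\in X:\langle x_n,y\rangle\in U_n\}$. Player I wins if either $\bigcap_{n<\omega}U_n[x_n]=\emptyset$ or the sequence $(x_n:n<\omega)$ converges in $X$; otherwise Player II wins. A space $X$ is semi-proximal if there is a uniformity $\mathfrak U$ on $X$ compatible with its topology such that Player II has no winning strategy in the proximal game on $(X,\mathfrak U)$. *)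

(* Defs.v *)
From HB Require Import structures.
From mathcomp Require Import all_boot all_order all_algebra.
From mathcomp Require Import all_classical.
From mathcomp Require Import topology_structure uniform_structure order_topology.
From mathcomp Require Import topology separation_axioms subtype_topology.
From mathcomp Require Import function_spaces.
From mathcomp Require wochoice.

Set Implicit Arguments.
Unset Strict Implicit.
Unset Printing Implicit Defensive.

Import Order.TTheory.
Local Open Scope classical_set_scope.
Local Open Scope order_scope.

(* The order type of W is omega_1. These three clauses determine W up to a
   unique order isomorphism; omega1_exists below provides such a W. As W is an
   orderTopologicalType, it carries the order topology. *)
Record is_omega1 (d : Order.disp_t) (W : orderTopologicalType d) : Prop := {
  omega1_wf : forall A : set W, A !=set0 -> exists2 m, A m & lbound A m;
  omega1_uncountable : ~ countable [set: W];
  omega1_segment : forall x : W, countable [set y | y < x]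
}.

Lemma uncountable_set_nat : ~ countable [set: set nat].
Proof.
move=> /countable_injP[f fi].
pose D := [set n | exists2 B, f B = n & ~ B n].
have [DfD|nDfD] := pselect (D (f D)); last by apply: (nDfD); exists D.
have [B fB nB] := DfD.
have BD : B = D by apply: fi => //; rewrite inE.
by apply: nB; rewrite BD.
Qed.

Lemma omega1_exists :
  exists d (W : orderTopologicalType d), is_omega1 W.
Proof.
have [R Rwo] := wochoice.well_ordering_principle (set nat).
have Rwoc : wochoice.wo_chain R predT by exact: wochoice.withinW.
have Rxx x : R x x by exact: (wochoice.wo_chain_reflexive Rwoc).
have Ranti : antisymmetric R.
  by move=> x y; apply: (wochoice.wo_chain_antisymmetric Rwoc).
have Rtot : total R by move=> x y; apply: (wochoice.wo_chainW Rwoc).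
have Rmin (A : set (set nat)) :
    A !=set0 -> exists2 m, A m & forall y, A y -> R m y.
  move=> [a Aa]; have [|m [[Am mlb] _]] := Rwo [pred x | `[< A x >]].
    by exists a; apply/asboolP.
  exists m; first exact/asboolP.
  by move=> y Ay; apply: mlb; exact/asboolP.
have Rtr : transitive R.
  move=> y x z Rxy Ryz.
  have [|m mxyz mlb] := Rmin [set x; y; z]; first by exists x; left; left.
  have [Rmx Rmy Rmz] : [/\ R m x, R m y & R m z].
    by split; apply: mlb; [left; left|left; right|right].
  case: mxyz => [[/= mx|/= my]|/= mz].
  - by rewrite -mx.
  - by rewrite (Ranti x y) // Rxy -my Rmx.
  - by rewrite -(Ranti y z) // Ryz -mz Rmy.
pose P := [pred y : set nat | `[< countable [set z | R z y] >]].
pose W0 : choiceType := {y : set nat | P y}.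
pose le := [rel u v : W0 | R (val u) (val v)].
pose lt (u v : W0) := (v != u) && le u v.
have le_anti : antisymmetric le by move=> u v /Ranti/val_inj.
have le_tr : transitive le by move=> u v w; exact: Rtr.
have le_tot : total le by move=> u v; exact: Rtot.
pose B := @Order.isOrder.Build Order.default_display W0 le lt
  (fun u v => if lt u v then u else v) (fun u v => if lt u v then v else u)
  (fun _ _ => erefl) (fun _ _ => erefl) (fun _ _ => erefl) le_anti le_tr le_tot.
pose oW : orderType Order.default_display := HB.pack (W0 : Type) (Choice.class W0) B.
have PW y : countable [set z | R z y] -> P y by move=> ?; exact/asboolP.
exists Order.default_display, (order_topology oW); split.
- move=> A [[a Pa] Aa].
  have [|m [Pm Am] mlb] :=
      Rmin [set y | exists Py : P y, A (exist _ y Py : W0)].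
    by exists a, Pa.
  exists (exist _ m Pm : W0) => // -[y Py] Ay.
  by apply: mlb; exists Py.
- move=> cW; have cP : countable [set y | P y].
    move: cW => /countable_injP[f fi]; apply/countable_injP.
    exists (fun y => if pselect (P y) is left Py then f (exist _ y Py : W0)
                     else 0%N).
    move=> x y /set_mem /= Px /set_mem /= Py.
    case: pselect => // Px'; case: pselect => // Py'.
    by move=> /fi; rewrite !in_setT => /(_ isT isT) [].
  have [|m nPm mlb] := Rmin (~` [set y | P y]).
    apply/set0P/eqP => /(congr1 setC); rewrite setCK setC0 => PT.
    by apply: uncountable_set_nat; rewrite -PT.
  apply: nPm; apply: PW.
  apply: (@sub_countable _ _ _ ([set y | P y] `|` [set m])).
    apply: subset_card_le => z /= Rzm.
    have [Pz|nPz] := pselect (P z); [by left|right].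
    by apply: Ranti; rewrite Rzm mlb.
  by rewrite -bigcup2E; apply: bigcup_countable => [|[|[|n]] _] //=.
- move=> x; have /asboolP := valP (x : W0).
  move=> /countable_injP[f fi]; apply/countable_injP.
  exists (fun u : W0 => f (val u)) => u v /set_mem ux /set_mem vx fuv.
  apply: val_inj; apply: fi fuv; apply/mem_set.
    by move: ux => /= /ltW.
  by move: vx => /= /ltW.
Qed.

Local Open Scope relation_scope.

(* E is a uniformity inducing the given topology of X: these are the fields of
   Nbhs_isUniform, as a predicate, so that E may vary over a fixed
   topological space. *)
Record compatible_uniformity (X : topologicalType) (E : set_system (X * X)) :
    Prop := {
  uniformity_filter : Filter E;
  uniformity_diagonal : forall A, E A -> diagonal `<=` A;
  uniformity_inv : forall A, E A -> E A^-1;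
  uniformity_split : forall A, E A -> exists2 B, E B & B \; B `<=` A;
  uniformity_nbhs : nbhs = nbhs_ E
}.

Local Close Scope relation_scope.

Lemma entourage_compatible (X : uniformType) :
  compatible_uniformity (@entourage X).
Proof.
split.
- exact: entourage_filter.
- exact: entourage_diagonal_subproof.
- exact: entourage_inv_subproof.
- exact: entourage_split_ex_subproof.
- exact: nbhsE_subproof.
Qed.

Section proximal_game.
Context {X : topologicalType}.
Implicit Types (E : set_system (X * X)) (U : nat -> set (X * X)) (x : nat -> X).

Definition playerI_legal E U := forall n, E (U n) /\ U n.+1 `<=` U n.

Definition playerII_legal U x := forall n, xsection (U n) (x n) (x n.+1).

Definition playerI_wins U x :=
  \bigcap_n xsection (U n) (x n) = set0 \/ exists l : X, x @ \oo --> l.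

(* Player II answers the entourage U_n, knowing the earlier innings
   (U_0, x_0), ..., (U_(n-1), x_(n-1)). *)
Definition strategyII := seq (set (X * X) * X) -> set (X * X) -> X.

Definition follows (s : strategyII) U x :=
  forall n, x n = s [seq (U i, x i) | i <- iota 0 n] (U n).

(* Requiring legality along infinite plays only is no loss: Player I can
   prolong every finite play by repeating the last entourage. *)
Definition winning_strategyII E (s : strategyII) :=
  forall U x, playerI_legal E U -> follows s U x ->
    playerII_legal U x /\ ~ playerI_wins U x.

End proximal_game.

(* If X is empty then Player II cannot make the first move; accordingly
   strategyII is an empty type. *)
Definition semi_proximal (X : topologicalType) :=
  exists2 E : set_system (X * X), compatible_uniformity E &
    ~ exists s : strategyII, winning_strategyII E s.

(* Main.v *)
Require Import Defs.
From mathcomp Require Import all_boot all_order all_algebra.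
From mathcomp Require Import all_classical.
From mathcomp Require Import topology_structure order_topology.
From mathcomp Require Import topology separation_axioms subtype_topology.
From mathcomp Require Import function_spaces.
From mathcomp Require Import reals normedtype lra Rstruct.

(* Player I uses the fine uniformity. Fix a strategy of Player II and a
   position, reachable against it, at which Player I has confined as many
   coordinates as possible to initial segments of omega_1 (the set B, with
   bounds a), the bounds being minimal. From then on no further coordinate can
   be confined and no bound lowered, so whenever Player I separates the ordinals
   at c, the answers of Player II exceed c in every coordinate outside B and in
   every coordinate i of B with c < a i. Hence Player I can make the play
   converge to the point with coordinates a on B and w off B, for every w in a
   certain club; this wins if that point lies in X for some such w.

   Otherwise {w | (a, w, ..., w) in X} is not stationary, and normality, through
   Fodor's lemma, gives a club C such that every point of the slice
   {x | x i = a i for i in B} has a coordinate outside C. The sets {x i notin C},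
   i notin B, then cover the slice, and each of them is a disjoint union of open
   sets on which x i is bounded. Urysohn functions turn these partitions into an
   entourage that confines some coordinate i notin B near every point of the
   slice. As no such coordinate can be confined, the play has no common point:
   it would have to lie in that slice. *)

Set Implicit Arguments.
Unset Strict Implicit.
Unset Printing Implicit Defensive.

Import Order.TTheory GRing.Theory Num.Theory numFieldTopology.Exports.
Import numFieldNormedType.Exports.
Local Open Scope classical_set_scope.
Local Open Scope order_scope.

(** * Clubs and stationary sets in omega_1 *)

Section omega1.
Context {d : Order.disp_t} {W : orderTopologicalType d} (hW : is_omega1 W).
Implicit Types (S : set W) (g : seq W -> W) (w c : W).

(** Finite lists as arguments let one [g] encode several closing-off conditions; [g [::]] bounds
    every closed [w] from below. *)
Definition closed_under g w := forall l, {in l, forall c, c < w} -> g l < w.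

(* The sets of closed_under g, for varying g, form a base of the club filter. *)
Definition stationary S := forall g, exists2 w, S w & closed_under g w.

Lemma omega1_min S : S !=set0 -> exists2 m, S m & forall y, S y -> m <= y.
Proof. by move=> /(omega1_wf hW)[m Sm mS]; exists m. Qed.


Lemma countable_le w : countable [set y | y <= w].
Proof.
apply: (@sub_countable _ _ _ (\bigcup_i bigcup2 [set y | y < w] [set w] i)).
  apply: subset_card_le => y /=; rewrite le_eqVlt => /orP[/eqP ->|yw].
    by exists 1%N.
  by exists 0%N.
apply: bigcup_countable => // -[|[|n]] _ //=; exact: (omega1_segment hW).
Qed.

(** Otherwise [W] would be a countable union of the countable segments up to the [f t]. *)
Lemma omega1_ub (T : countType) (f : T -> W) : exists b, forall t, f t < b.
Proof.
apply: contrapT => /forallNP nb; apply: (omega1_uncountable hW).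
have -> : [set: W] = \bigcup_(t in [set: T]) [set y | y <= f t].
  rewrite eqEsubset; split=> // b _.
  by have /existsNP[t /negP] := nb b; rewrite -leNgt => bt; exists t.
by apply: bigcup_countable => // t _; exact: countable_le.
Qed.

Lemma omega1_enum b c0 : c0 < b ->
  exists2 c : nat -> W, (forall j, c j < b) & forall w, w < b -> exists j, c j = w.
Proof.
move=> c0b; have /countable_injP[f fi] := omega1_segment hW b.
pose c j := if pselect (exists2 y, y < b & f y = j) is left e then
  sval (cid2 e) else c0.
exists c => [j|w wb].
  by rewrite /c; case: pselect => // e; case: cid2.
exists (f w); rewrite /c; case: pselect => [e|]; last by case; exists w.
by case: cid2 => /= y yb /fi; rewrite !inE; apply.
Qed.

Lemma omega1_fin_ub (n : nat) (f : 'I_n -> W) : exists b, forall i, f i < b.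
Proof. exact: (@omega1_ub 'I_n). Qed.

Lemma omega1_gt w : exists b, w < b.
Proof. by have [b /(_ tt)] := omega1_ub (fun _ : unit => w); exists b. Qed.

(** There are only countably many finite lists below [w]. *)
Lemma closed_under_step g w :
  exists2 b, w < b & forall l, {in l, forall c, c < w} -> g l < b.
Proof.
have [[c0 c0w]|nw] := pselect (exists c0, c0 < w).
  have [e _ ew] := omega1_enum c0w.
  have [b gb] :=
    omega1_ub (fun o => if o is Some l then g [seq e j | j <- l] else w).
  exists b; first exact: (gb None).
  move=> l lw; suff [l' ->] : exists l', l = [seq e j | j <- l'].
    exact: (gb (Some l')).
  elim: l lw => [|a l IH] lw; first by exists [::].
  have [|l' ->] := IH; first by move=> c cl; apply: lw; rewrite inE cl orbT.
  have [|j <-] := ew a; first by apply: lw; rewrite inE eqxx.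
  by exists (j :: l').
have [b gb] := omega1_ub (fun o => if o is Some tt then g [::] else w).
exists b; first exact: (gb None).
move=> [|a l] lw; first exact: (gb (Some tt)).
by case: nw; exists a; apply: lw; rewrite inE eqxx.
Qed.

(** Iterate the previous step; a finite list below the least strict bound of all stages already lies
    below one stage. *)
Lemma closed_under_unbounded g w : exists2 b, w < b & closed_under g b.
Proof.
pose step a := sval (cid2 (closed_under_step g a)).
have stepgt a : a < step a by rewrite /step; case: cid2.
have stepg a l : {in l, forall c, c < a} -> g l < step a.
  by rewrite /step; case: cid2 => /= b _; apply.
pose a n := iter n step w.
have a_le m n : (m <= n)%N -> a m <= a n.
  move=> /subnK <-; elim: (n - m)%N => //= k; move=> /le_trans; apply.
  exact/ltW/stepgt.
have [|b ab bmin] := @omega1_min [set b | forall n, a n < b].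
  by have [b] := omega1_ub a; exists b.
exists b; first exact: (ab 0%N).
have lt_a c : c < b -> exists n, c < a n.
  move=> cb; apply: contrapT => /forallNP nc; suff : b <= c by rewrite leNgt cb.
  apply: bmin => n /=; apply: (lt_le_trans (stepgt _)).
  by rewrite leNgt; apply/negP; exact: (nc n.+1).
move=> l lb; suff [n ln] : exists n, {in l, forall c, c < a n}.
  exact: (lt_trans (stepg _ _ ln) (ab n.+1)).
elim: l lb => [|c l IH] lb; first by exists 0%N.
have [|n ln] := IH; first by move=> y yl; apply: lb; rewrite inE yl orbT.
have [|m cm] := lt_a c; first by apply: lb; rewrite inE eqxx.
exists (maxn m n) => y; rewrite inE => /orP[/eqP ->|/ln yn].
  by apply: (lt_le_trans cm); apply: a_le; exact: leq_maxl.
by apply: (lt_le_trans yn); apply: a_le; exact: leq_maxr.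
Qed.

Lemma closed_underW g g' w : (forall l, g l <= g' l) ->
  closed_under g' w -> closed_under g w.
Proof. by move=> gg' cw l /cw; apply: le_lt_trans. Qed.

Lemma stationary_gt S w g : stationary S ->
  exists b, [/\ S b, w < b & closed_under g b].
Proof.
move=> sS; have [b Sb cb] := sS (fun l => Order.max w (g l)); exists b.
split=> //; last by apply: closed_underW cb => l; rewrite le_max lexx orbT.
by have := cb [::]; rewrite gt_max => /(_ _)/andP[].
Qed.

Lemma stationaryI S g : stationary S ->
  stationary [set w | S w /\ closed_under g w].
Proof.
move=> sS g'; have [b Sb cb] := sS (fun l => Order.max (g l) (g' l)).
exists b; first split=> //.
  by apply: closed_underW cb => l; rewrite le_max lexx.
by apply: closed_underW cb => l; rewrite le_max lexx orbT.
Qed.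


(* Fodor's lemma; prepending the argument to the list is a diagonal
   intersection. *)
Lemma pressing_down S (h : W -> W) : stationary S ->
  (forall w, S w -> h w < w) ->
  exists a, stationary [set w | S w /\ h w = a].
Proof.
move=> sS hlt; apply: contrapT => /forallNP ns.
have /choice[G GP] a :
    exists g, forall w, S w -> h w = a -> ~ closed_under g w.
  have /existsNP[g gP] := ns a; exists g => w Sw hw cw.
  by apply: gP; exists w.
have [w0 _] := omega1_ub (fun v : void => match v with end).
have [w Sw cw] := sS (fun l => if l is a :: l' then G a l' else w0).
apply: (GP _ _ Sw erefl) => l lw; apply: (cw (h w :: l)) => c.
by rewrite inE => /orP[/eqP ->|/lw//]; exact: hlt.
Qed.

(** * Neighbourhoods in the order topology *)

Lemma omega1_open_gt w : open [set y | w < y].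
Proof. by have := rray_open w; rewrite set_itvE. Qed.

(** The set is the open ray below the successor [s] of [w]. *)
Lemma omega1_open_le w : open [set y | y <= w].
Proof.
have [b wb] := omega1_gt w.
have [|s ws smin] := @omega1_min [set y | w < y]; first by exists b.
have -> : [set y | y <= w] = [set y | y < s].
  apply/seteqP; split=> y /= yw; first exact: le_lt_trans ws.
  by rewrite leNgt; apply/negP => /smin; rewrite leNgt yw.
by have := lray_open s; rewrite set_itvE.
Qed.

Lemma nbhs_omega1_gt w c : c < w -> nbhs w [set y | c < y].
Proof. by move=> cw; apply: open_nbhs_nbhs; split => //; exact: omega1_open_gt. Qed.

Lemma nbhs_omega1_le w c : w <= c -> nbhs w [set y | y <= c].
Proof. by move=> wc; apply: open_nbhs_nbhs; split => //; exact: omega1_open_le. Qed.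

Lemma nbhs_omega1P w (N : set W) : nbhs w N ->
  (forall y, y <= w -> N y) \/
  exists2 c, c < w & forall y, c < y -> y <= w -> N y.
Proof.
rewrite itv_nbhsE => -[[l r] [oi wi] iN].
have ir y : y <= w -> (BRight y <= r)%O.
  move: wi; rewrite in_itv /= => /andP[_ wr] yw.
  by case: r wr {oi iN} => [[] r|[]] //=; rewrite bnd_simp => wr;
    [exact: le_lt_trans wr | exact: le_trans wr].
case: l oi wi iN => [[] c|[]].
- by case: r {ir} => [[] r|[]].
- move=> _ wi iN; right; exists c.
    by move: wi; rewrite inE => /andP[]; rewrite bnd_simp.
  move=> y cy yw; apply: iN => /=; rewrite inE; apply/andP; split.
    by rewrite bnd_simp.
  exact: ir.
- move=> _ _ iN; left => y yw; apply: iN => /=; rewrite inE; apply/andP; split.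
    by [].
  exact: ir.
- by move=> _; rewrite inE => /andP[].
Qed.

(** A list [l] witnessing the failure at [w] still does so near [w], and every closed ordinal at or
    above such a point exceeds [g l]. So these points lie in one gap of the club. *)
Lemma nbhs_not_closed_under g w : ~ closed_under g w ->
  nbhs w [set y | ~ closed_under g y /\
                  forall b, closed_under g b -> (w <= b) = (y <= b)].
Proof.
move=> /existsNP[l /not_implyP[lw /negP]]; rewrite -leNgt => wg.
have : nbhs w [set y | {in l, forall c, c < y} /\ y <= g l].
  apply: filterI; last exact: nbhs_omega1_le.
  elim: l lw {wg} => [|c l IH] lw; first by apply: filterS filterT => y _ c.
  have lw' : {in l, forall c, c < w}.
    by move=> y yl; apply: lw; rewrite inE yl orbT.
  have cw : c < w by apply: lw; rewrite inE eqxx.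
  apply: filterS (filterI (nbhs_omega1_gt cw) (IH lw')) => y [cy ly] z.
  by rewrite inE => /orP[/eqP ->|/ly].
have key z b : {in l, forall c, c < z} -> closed_under g b -> z <= b -> g l < b.
  by move=> lz cb zb; apply: cb => c /lz cz; exact: lt_le_trans zb.
apply: filterS => y [ly yg]; split=> [cy|b cb].
  by have := cy _ ly; rewrite ltNge yg.
apply/idP/idP => [/(key _ _ lw cb) gb|/(key _ _ ly cb) gb].
  exact: le_trans (ltW gb).
exact: le_trans (ltW gb).
Qed.

Lemma nbhs_Ioc w (N : set W) c0 : nbhs w N -> c0 < w ->
  exists c, [/\ c0 <= c, c < w & forall y, c < y -> y <= w -> N y].
Proof.
move=> /nbhs_omega1P[Nw|[c cw cN]] c0w; first by exists c0; split=> // y _ /Nw.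
exists (Order.max c0 c); rewrite gt_max cw c0w le_max lexx; split=> // y.
by rewrite gt_max => /andP[_]; exact: cN.
Qed.

Lemma cvg_omega1 (u : nat -> W) w : (forall n, u n <= w) ->
  (forall c, c < w -> \forall n \near \oo, c < u n) -> u @ \oo --> w.
Proof.
move=> uw ugt N /nbhs_omega1P[Nw|[c cw cN]].
  by exists 0%N => // n _; exact: Nw.
by have [n _ ugtc] := ugt _ cw; exists n => // m /ugtc cm; exact: cN.
Qed.

End omega1.

(** * The fine uniformity *)

Section fine_uniformity.
Context {R : realType} {X : topologicalType}.
Local Open Scope ring_scope.
Implicit Types (rho : X -> X -> R) (f : X -> R) (e : R) (A : set (X * X)).

Lemma near_dist f x e : continuous f -> 0 < e ->
  nbhs x [set y | `|f x - f y| < e].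
Proof. by move=> fc e0; move/cvgrPdist_lt: (fc x) => /(_ _ e0). Qed.

Record continuous_pseudometric rho : Prop := {
  pseudometric_refl : forall x, rho x x = 0;
  pseudometric_sym : forall x y, rho x y = rho y x;
  pseudometric_triangle : forall x y z, rho x z <= rho x y + rho y z;
  pseudometric_nbhs : forall x e, 0 < e -> nbhs x [set y | rho x y < e]
}.

Definition fine_uniformity : set_system (X * X) := [set A |
  exists rho (e : R), [/\ continuous_pseudometric rho, 0 < e &
                    forall x y, rho x y < e -> A (x, y)]].

Lemma pseudometric_ge0 rho x y : continuous_pseudometric rho -> 0 <= rho x y.
Proof.
move=> hrho; have := pseudometric_triangle hrho x y x.
by rewrite pseudometric_refl // (pseudometric_sym hrho y x); lra.
Qed.

Lemma fine_uniformity_filter : Filter fine_uniformity.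
Proof.
split.
- exists (fun _ _ => 0), 1; split=> //; split=> // [x y z|x e e0].
    by rewrite addr0.
  by apply: filterS filterT => y _.
- move=> A B [r [e [hr e0 rA]]] [s [f [hs f0 sB]]].
  (* The sum dominates both pseudometrics. *)
  exists (fun x y => r x y + s x y), (Num.min e f); split.
  + split.
    * by move=> x; rewrite !pseudometric_refl // addr0.
    * by move=> x y; rewrite (pseudometric_sym hr) (pseudometric_sym hs).
    * move=> x y z; have := pseudometric_triangle hr x y z.
      by have := pseudometric_triangle hs x y z; lra.
    * move=> x u u0; have u2 : 0 < u / 2 by lra.
      apply: filterS (filterI (pseudometric_nbhs hr x u2)
        (pseudometric_nbhs hs x u2)) => y /= [ry sy]; lra.
  + by rewrite lt_min e0.
  + move=> x y; have := pseudometric_ge0 x y hr; have := pseudometric_ge0 x y hs.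
    by rewrite lt_min => s0 r0 /andP[re rf]; split; [apply: rA|apply: sB]; lra.
- move=> A B AB [r [e [hr e0 rA]]]; exists r, e; split=> // x y /rA.
  exact: AB.
Qed.

(* In the hedgehog metric, points that are not e-related are joined through
   the zero set of f. *)
Lemma fine_uniformity_hedgehog (f : X -> R) (e : X -> X -> Prop) (c : R) :
  continuous f -> (forall x, 0 <= f x) ->
  (forall x y, e x y -> e y x) -> (forall x y z, e x y -> e y z -> e x z) ->
  (forall x, 0 < f x -> nbhs x (e x)) -> 0 < c ->
  fine_uniformity [set p | c <= f p.1 -> e p.1 p.2].
Proof.
move=> fc f0 esym etr enbhs c0.
pose rho x y := if `[< e x y >] then `|f x - f y| else f x + f y.
have rho_le x y : rho x y <= f x + f y.
  rewrite /rho; case: ifP => // _; rewrite ler_norml.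
  by have := f0 x; have := f0 y; lra.
have le_rho x y : `|f x - f y| <= rho x y.
  rewrite /rho; case: ifP => // _; rewrite ler_norml.
  by have := f0 x; have := f0 y; lra.
exists rho, c; split=> //; last first.
  move=> x y /= + cx; rewrite /rho; case: asboolP => // _.
  by have := f0 y; lra.
split.
- move=> x; rewrite /rho; case: asboolP => [_|nx]; first by rewrite subrr normr0.
  have : ~ 0 < f x by move=> /enbhs/nbhs_singleton.
  by have := f0 x; move=> ? /negP; lra.
- move=> x y; rewrite /rho distrC (addrC (f x)); congr (if _ then _ else _).
  by apply: asbool_equiv_eq; split; exact: esym.
- move=> x y z; rewrite {1}/rho; case: asboolP => [xz|nxz].
    have := le_rho x y; have := le_rho y z.
    by have := ler_distD (f y) (f x) (f z); lra.
  rewrite /rho; case: asboolP => [xy|_]; case: asboolP => [yz|_].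
  + by case: nxz; exact: etr yz.
  + by have := ler_norm (f x - f y); lra.
  + by have := ler_norm (f z - f y); rewrite distrC; lra.
  + by have := f0 y; lra.
(* At a zero of [f] the class of [x] need not be a neighbourhood; there [rho x y <= f y]
   suffices. *)
- move=> x u u0; have [fx0|fx0] := ltP 0 (f x).
    apply: filterS (filterI (enbhs _ fx0) (near_dist x fc u0)) => y [exy fxy] /=.
    by rewrite /rho; case: asboolP.
  have fx : f x = 0 by have := f0 x; lra.
  apply: filterS (near_dist x fc u0) => y /=; rewrite fx sub0r.
  rewrite normrN ger0_norm // => fyu; apply: le_lt_trans fyu.
  by have := rho_le x y; rewrite fx add0r.
Qed.

(** The hedgehog over the constant function 1: related points have distance 0, unrelated ones
    distance 2. *)
Lemma fine_uniformity_open_relation (e : X -> X -> Prop) :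
  (forall x y, e x y -> e y x) -> (forall x y z, e x y -> e y z -> e x z) ->
  (forall x, nbhs x (e x)) -> fine_uniformity [set p | e p.1 p.2].
Proof.
move=> esym etr enbhs.
have [_ _ up] := fine_uniformity_filter.
apply: up (@fine_uniformity_hedgehog (fun=> 1) e 1 (@cst_continuous _ _ _)
  (fun=> ler01) esym etr (fun x _ => enbhs x) ltr01).
by move=> p /=; apply.
Qed.

Lemma fine_uniformity_continuous (f : X -> R) (c : R) :
  continuous f -> 0 < c -> fine_uniformity [set p | `|f p.1 - f p.2| < c].
Proof.
move=> fc c0; exists (fun x y => `|f x - f y|), c; split=> //; split.
- by move=> x; rewrite subrr normr0.
- by move=> x y; rewrite distrC.
- by move=> x y z; exact: ler_distD.
- by move=> x u u0; exact: (near_dist x fc u0).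
Qed.

Lemma fine_uniformity_compatible :
  (forall x (N : set X), nbhs x N ->
     exists2 A, fine_uniformity A & xsection A x `<=` N) ->
  compatible_uniformity fine_uniformity.
Proof.
move=> creg; split.
- exact: fine_uniformity_filter.
- move=> A [r [e [hr e0 rA]]] [x y] /= /diagonalP ->; apply: rA.
  by rewrite pseudometric_refl.
- move=> A [r [e [hr e0 rA]]]; exists r, e; split=> // x y.
  by rewrite (pseudometric_sym hr) => /rA.
- move=> A [r [e [hr e0 rA]]]; exists [set p | r p.1 p.2 < e / 2].
    by exists r, (e / 2); split=> //; lra.
  move=> [x z] [y /= xy yz]; apply: rA.
  by have := pseudometric_triangle hr x y z; lra.
- apply/funext => x; rewrite nbhs_E; apply/seteqP; split=> N.
    by move=> /creg[A EA AN]; exists A.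
  move=> [A [r [e [hr e0 rA]]]] /filterS; apply.
  have := pseudometric_nbhs hr x e0; apply: filterS => y /= xy.
  by apply/xsectionP; exact: rA.
Qed.

End fine_uniformity.
Arguments fine_uniformity : clear implicits.

(** * Normality and stationary slices *)

Lemma normal_urysohn (R : realType) (X : topologicalType) (A B : set X) :
  normal_space X -> closed A -> closed B -> A `&` B = set0 ->
  exists f : X -> R, [/\ continuous f, forall x, (0 <= f x)%R,
    forall x, A x -> f x = 0%R & forall x, B x -> f x = 1%R].
Proof.
move=> nX cA cB AB0.
have /(@uniform_separatorP _ R)[f [fc f01 fA fB]] :=
  (@normal_separatorP R X).1 nX A B cA cB AB0.
exists f; split=> // x.
- have /f01 : range f (f x) by exists x.
  by rewrite /= in_itv /= => /andP[].
- by move=> Ax; apply: fA; exists x.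
- by move=> Bx; apply: fB; exists x.
Qed.

Lemma closed_nbhsC (X : topologicalType) (F : set X) :
  (forall x, ~ F x -> nbhs x [set y | ~ F y]) -> closed F.
Proof. by move=> h; rewrite -openC openE => x; exact: h. Qed.

(** * Coordinates, slices and graphs *)

Section coordinates.
Context {d : Order.disp_t} {W : orderTopologicalType d} (hW : is_omega1 W).
Context {X : topologicalType} {k : nat} (p : 'I_k -> X -> W).

(** The initial topology of the maps [p i], given by boxes; it keeps the argument away from subtypes
    of products. *)
Definition initial_coordinates := forall x (N : set X), nbhs x N <->
  exists2 V : 'I_k -> set W, forall i, nbhs (p i x) (V i) &
    forall y, (forall i, V i (p i y)) -> N y.

Hypothesis hp : initial_coordinates.
Implicit Types (i j : 'I_k) (x y : X) (B J : {set 'I_k}) (a : 'I_k -> W).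

Lemma nbhs_coord i x (N : set W) :
  nbhs (p i x) N -> nbhs x [set y | N (p i y)].
Proof.
move=> Nx; apply/hp; exists (fun j => if j == i then N else setT) => [j|y].
  by case: eqVneq => [->//|_]; exact: filterT.
by move=> /(_ i); rewrite eqxx.
Qed.

Lemma nbhs_coord_neq i j x : p i x <> p j x ->
  nbhs x [set y | p i y <> p j y].
Proof.
wlog ij : i j / p i x < p j x => [h nij|_].
  have /orP[ij|ji] : (p i x < p j x) || (p j x < p i x).
  - by rewrite -neq_lt; exact/eqP.
  - exact: h.
  - by apply: filterS (h _ _ ji (nesym nij)) => y /nesym.
apply: filterS (filterI (nbhs_coord (nbhs_omega1_le hW (lexx (p i x))))
  (nbhs_coord (nbhs_omega1_gt ij))) => y [/= yi yj] ye.
by move: yj; rewrite -ye ltNge yi.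
Qed.

Lemma nbhs_coord_neq_cst i x c : p i x <> c -> nbhs x [set y | p i y <> c].
Proof.
move=> /eqP; rewrite neq_lt => /orP[ic|ci].
  apply: filterS (nbhs_coord (nbhs_omega1_le hW (lexx (p i x)))) => y /= yi ye.
  by move: ic; rewrite -ye ltNge yi.
by apply: filterS (nbhs_coord (nbhs_omega1_gt ci)) => y /= + ye; rewrite ye ltxx.
Qed.

(** With the coordinates in [B] fixed, the slice is viewed in the plane of pairs [(b, c)]; [B] takes
    precedence over [J]. *)
Definition at_pair B J a (b c : W) x :=
  forall i, p i x = if i \in B then a i else if i \in J then b else c.

Lemma nbhs_at_pair B J a b c b0 c0 x N : at_pair B J a b c x -> nbhs x N ->
  b0 < b -> c0 < c ->
  exists b1 c1, [/\ b1 < b, c1 < c & forall b' c' y, b1 < b' -> b' <= b ->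
    c1 < c' -> c' <= c -> at_pair B J a b' c' y -> N y].
Proof.
move=> atx /hp[V nV VN] b0b c0c.
have nb : nbhs b [set w | forall i, i \notin B -> i \in J -> V i w].
  apply: filter_forall => i; case: (boolP ((i \notin B) && (i \in J))).
    case/andP=> iB iJ; have := nV i; rewrite atx (negPf iB) iJ.
    by apply: filterS.
  by move=> /negP nij; apply: filterS filterT => w _ iB iJ; case: nij; apply/andP.
have nc : nbhs c [set w | forall i, i \notin B -> i \notin J -> V i w].
  apply: filter_forall => i; case: (boolP ((i \notin B) && (i \notin J))).
    case/andP=> iB iJ; have := nV i; rewrite atx (negPf iB) (negPf iJ).
    by apply: filterS.
  by move=> /negP nij; apply: filterS filterT => w _ iB iJ; case: nij; apply/andP.
have [b1 [_ b1b b1V]] := nbhs_Ioc nb b0b.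
have [c1 [_ c1c c1V]] := nbhs_Ioc nc c0c.
exists b1, c1; split=> // b' c' y bb' b'b cc' c'c aty; apply: VN => i.
rewrite aty; case: (boolP (i \in B)) => iB.
  by have /nbhs_singleton := nV i; rewrite atx iB.
case: (boolP (i \in J)) => iJ; first exact: b1V.
exact: c1V.
Qed.

(* Every point has a neighbourhood meeting the set over at most one w: by the
   spacing of S the graph accumulates only at diagonal points over ordinals
   closed under g, and these are missing. *)
Lemma closed_graph B J a (S : set W) g (b : W -> W) j0 i0 :
  j0 \in J -> j0 \notin B -> i0 \notin J -> i0 \notin B ->
  (forall w, S w -> [/\ closed_under g w, w < b w &
     forall w', S w' -> w < w' -> b w < w']) ->
  (forall w x, closed_under g w -> ~ at_pair B J a w w x) ->
  closed [set x | exists2 w, S w & at_pair B J a w (b w) x].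
Proof.
move=> j0J j0B i0J i0B hS ndiag; set F := [set x | _].
have pj0 w c x : at_pair B J a w c x -> p j0 x = w.
  by move=> ->; rewrite (negPf j0B) j0J.
have pi0 w c x : at_pair B J a w c x -> p i0 x = c.
  by move=> ->; rewrite (negPf i0B) (negPf i0J).
apply: closed_nbhsC => x nFx.
(* Such an [N] meets the graph over at most one [w], and a coordinate in which [x] differs from the
   points over [w] excludes these as well. *)
suff [N Nx N1] : exists2 N, nbhs x N & forall w w' y y', S w -> S w' ->
    N y -> N y' -> at_pair B J a w (b w) y -> at_pair B J a w' (b w') y' ->
    w < w' -> False.
  have {N1} N1 w w' y y' : S w -> S w' -> N y -> N y' ->
      at_pair B J a w (b w) y -> at_pair B J a w' (b w') y' -> w = w'.
    move=> Sw Sw' Ny Ny' wy wy'; apply/eqP; case: ltgtP => // ww'.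
    - by have := N1 _ _ _ _ Sw Sw' Ny Ny' wy wy' ww'.
    - by have := N1 _ _ _ _ Sw' Sw Ny' Ny wy' wy ww'.
  have [[y [Ny [w Sw wy]]]|nNF] := pselect (exists y, N y /\ F y); last first.
    by apply: filterS Nx => y Ny Fy; apply: nNF; exists y.
  have /existsNP[i pix] : ~ at_pair B J a w (b w) x by move=> ?; apply: nFx; exists w.
  apply: filterS (filterI Nx (nbhs_coord_neq_cst pix)) => y' [Ny' pny'].
  move=> [w' Sw' wy']; apply: pny'.
  by rewrite (N1 _ _ _ _ Sw Sw' Ny Ny' wy wy').
have [lt|gt|eq] := ltgtP (p j0 x) (p i0 x).
- exists [set y | p j0 y <= p j0 x /\ p j0 x < p i0 y].
    exact: (filterI (nbhs_coord (nbhs_omega1_le hW (lexx (p j0 x))))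
      (nbhs_coord (nbhs_omega1_gt lt))).
  move=> w w' y y' Sw Sw' [_ y2] [y1' _] wy wy' ww'.
  have [_ _ /(_ _ Sw' ww')] := hS _ Sw.
  rewrite -(pi0 _ _ _ wy) -(pj0 _ _ _ wy') => yy'.
  by have := lt_trans y2 (lt_le_trans yy' y1'); rewrite ltxx.
- exists [set y | p i0 x < p j0 y /\ p i0 y <= p i0 x].
    exact: (filterI (nbhs_coord (nbhs_omega1_gt gt))
      (nbhs_coord (nbhs_omega1_le hW (lexx (p i0 x))))).
  move=> w w' y y' Sw Sw' [y1 y2] _ wy _ _.
  have [_ + _] := hS _ Sw; rewrite -(pi0 _ _ _ wy) -{1}(pj0 _ _ _ wy).
  by rewrite ltNge (le_trans y2 (ltW y1)).
(* Now [p j0 x = p i0 x]. Off the club, nearby values of [p j0] are not closed either; on it,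
   [ndiag] gives a coordinate that breaks the pattern, and it does so nearby too. *)
have [cx|ncx] := pselect (closed_under g (p j0 x)); last first.
  exists [set y | ~ closed_under g (p j0 y)].
    by apply: (nbhs_coord (N := [set w | ~ closed_under g w]));
      apply: filterS (nbhs_not_closed_under hW ncx) => y [].
  move=> w w' y y' Sw Sw' yc _ wy _ _; apply: yc; rewrite (pj0 _ _ _ wy).
  by case: (hS _ Sw).
have /existsNP[i] := ndiag _ x cx; case: ifP => iB.
  move=> pix; exists [set y | p i y <> a i]; first exact: nbhs_coord_neq_cst.
  by move=> w w' y y' _ _ + _ wy _ _; apply; rewrite wy iB.
case: ifP => iJ pix.
  exists [set y | p i y <> p j0 y]; first exact: nbhs_coord_neq.
  move=> w w' y y' _ _ + _ wy _ _; apply; rewrite (pj0 _ _ _ wy) wy.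
  by rewrite iB iJ.
exists [set y | p i y <> p i0 y].
  by apply: nbhs_coord_neq; rewrite -eq.
move=> w w' y y' _ _ + _ wy _ _; apply; rewrite (pi0 _ _ _ wy) wy.
by rewrite iB iJ.
Qed.

End coordinates.

Section normal_slices.
Context {d : Order.disp_t} {W : orderTopologicalType d} (hW : is_omega1 W).
Context (R : realType) {X : topologicalType} {k : nat} (p : 'I_k -> X -> W).
Hypothesis hp : initial_coordinates p.
Hypothesis nX : normal_space X.
Implicit Types (i j : 'I_k) (x y : X) (B J : {set 'I_k}) (a : 'I_k -> W).

(* If the diagonal misses a club, choose two points over each b in S, both below
   the next member of a smaller club. The two graphs obtained are closed and
   disjoint, but by Fodor's lemma every neighbourhood of either of them is
   unbounded on the line over some fixed b0 in S, so they cannot be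
   separated. *)
Lemma stationary_diagonal B J a (S : set W) j0 i0 :
  j0 \in J -> j0 \notin B -> i0 \notin J -> i0 \notin B -> stationary S ->
  (forall b, S b -> stationary [set c | exists x, at_pair p B J a b c x]) ->
  stationary [set c | exists x, at_pair p B J a c c x].
Proof.
move=> j0J j0B i0J i0B sS sG; apply: contrapT => /existsNP[g0 ng0].
have ndiag w x : closed_under g0 w -> ~ at_pair p B J a w w x.
  by move=> cw atx; apply: ng0; exists w => //; exists x.
pose w0 := g0 [::].
have /choice[nG nGP] (bc : W * W) : exists c, S bc.1 ->
    bc.2 < c /\ exists x, at_pair p B J a bc.1 c x.
  have [Sb|] := pselect (S bc.1); last by exists w0.
  by have [c [? ? _]] := stationary_gt bc.2 g0 (sG _ Sb); exists c.
(* Closure under [g1] keeps the two heights chosen over [b] above [nG] of any pair of ordinals below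
   them. *)
pose g1 l := Order.max (g0 l) (if l is [:: b; c] then nG (b, c) else w0).
have /choice[s sP] b : exists s : W * W, S b -> [/\ b < s.1, s.1 < s.2,
    exists x, at_pair p B J a b s.1 x, exists x, at_pair p B J a b s.2 x &
    closed_under g1 s.1 /\ closed_under g1 s.2].
  have [Sb|] := pselect (S b); last by exists (w0, w0).
  have [c [Gc bc cc]] := stationary_gt b g1 (sG _ Sb).
  by have [e [Ge ce ec]] := stationary_gt c g1 (sG _ Sb); exists (c, e).
(* This spaces [Z]: both heights over a member lie below every larger member. *)
pose g2 l := Order.max (g0 l) (if l is [:: b] then (s b).2 else w0).
pose Z := [set b | S b /\ closed_under g2 b].
have sZ : stationary Z by exact: stationaryI.
have g20 w : closed_under g2 w -> closed_under g0 w.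
  by apply: closed_underW => l; rewrite le_max lexx.
have sZlt b b' : Z b -> Z b' -> b < b' -> (s b).2 < b'.
  move=> [Sb _] [_ cb'] bb'; have := cb' [:: b]; rewrite gt_max.
  by move=> /(_ _)/andP[] // c; rewrite inE => /eqP ->.
have closedG (t : W * W -> W) : (forall b, S b -> b < t (s b) /\ t (s b) <= (s b).2) ->
    closed [set x | exists2 b, Z b & at_pair p B J a b (t (s b)) x].
  move=> tP; apply: (closed_graph hW hp j0J j0B i0J i0B) => [b Zb|w x /g20].
    have [bt tb] := tP _ Zb.1; split=> // [|b' Zb' bb']; first by case: Zb.
    exact: le_lt_trans tb (sZlt _ _ Zb Zb' bb').
  exact: ndiag.
have cF : closed [set x | exists2 b, Z b & at_pair p B J a b (s b).1 x].
  by apply: (closedG fst) => b /sP[? /ltW].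
have cH : closed [set x | exists2 b, Z b & at_pair p B J a b (s b).2 x].
  by apply: (closedG snd) => b /sP[bs ss]; rewrite (lt_trans bs ss).
have pj0 w c x : at_pair p B J a w c x -> p j0 x = w.
  by move=> ->; rewrite (negPf j0B) j0J.
have pi0 w c x : at_pair p B J a w c x -> p i0 x = c.
  by move=> ->; rewrite (negPf i0B) (negPf i0J).
have FH0 : [set x | exists2 b, Z b & at_pair p B J a b (s b).1 x] `&`
    [set x | exists2 b, Z b & at_pair p B J a b (s b).2 x] = set0.
  rewrite -subset0 => x [[b Zb xb] [b' Zb' xb']].
  have [_ ss _ _ _] := sP _ Zb.1.
  move: ss; rewrite -(pi0 _ _ _ xb) (pi0 _ _ _ xb').
  by rewrite -(pj0 _ _ _ xb) (pj0 _ _ _ xb') ltxx.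
have [f [fc _ fF fH]] := normal_urysohn R nX cF cH FH0; clear FH0.
pose V (q : bool) := [set x | if q then (2/3 < f x)%R else (f x < 1/3)%R].
pose t (q : bool) (c : W * W) := if q then c.2 else c.1.
have nV q b x : Z b -> at_pair p B J a b (t q (s b)) x -> nbhs x (V q).
  have e3 : (0 < 1/3 :> R)%R by lra.
  have nf := near_dist x fc e3.
  case: q => Zb xb; apply: filterS nf => y; rewrite /V /= ltr_norml => /andP[].
    by rewrite (fH x); [lra | exists b].
  by rewrite (fF x); [lra | exists b].
have stP q b : S b -> [/\ b < t q (s b), exists x, at_pair p B J a b (t q (s b)) x &
    closed_under g1 (t q (s b))].
  by move=> /sP[bs ss G1 G2 []]; case: q => // _ ?; split=> //; exact: lt_trans ss.
have /choice[h hP] (qb : bool * W) : exists h : W * W, Z qb.2 ->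
    [/\ h.1 < qb.2, h.2 < t qb.1 (s qb.2) & forall b c y, h.1 < b -> b <= qb.2 ->
    h.2 < c -> c <= t qb.1 (s qb.2) -> at_pair p B J a b c y -> V qb.1 y].
  case: qb => q b; have [Zb|] := pselect (Z b); last by exists (w0, w0).
  have [bt [x xb] _] := stP q b Zb.1.
  have w0b : w0 < b by apply: (g20 _ Zb.2 [::]).
  have [b1 [c1 [? ? ?]]] :=
    nbhs_at_pair hp xb (nV _ _ _ Zb xb) w0b bt.
  by exists (b1, c1).
(* By Fodor's lemma, the boxes around both graphs begin at or before one [v1], for stationary many
   [b]. *)
have [v1 sv1] : exists v1, stationary
    [set b | Z b /\ Order.max (h (false, b)).1 (h (true, b)).1 = v1].
  apply: (pressing_down hW) => // b Zb; rewrite gt_max.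
  by have [-> _ _] := hP (false, b) Zb; have [-> _ _] := hP (true, b) Zb.
have [b0 [Sb0 ab0 _]] := stationary_gt v1 g0 sS.
have unb q c : exists e, c < e /\ exists2 x, at_pair p B J a b0 e x & V q x.
  have [b [[Zb hb] bgt _]] := stationary_gt (Order.max c b0) g0 sv1.
  move: bgt; rewrite gt_max => /andP[cb b0b].
  have [bt _ ct] := stP q b Zb.1.
  have [h1 h2 hV] := hP (q, b) Zb.
  (* The height [nG (b0, m)] exceeds the lower end of the box and, by closure under [g1], stays
     below its top. *)
  pose m := Order.max b (h (q, b)).2.
  have [me [x xe]] := nGP (b0, m) Sb0.
  exists (nG (b0, m)); split.
    by apply: lt_trans me; rewrite lt_max cb.
  exists x => //; apply: (hV _ _ _ _ (ltW b0b) _ _ xe).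
  - apply: le_lt_trans ab0; rewrite -hb le_max.
    by case: (q); rewrite lexx ?orbT.
  - by apply: le_lt_trans me; rewrite le_max lexx orbT.
  - have := ct [:: b0; m]; rewrite gt_max => /(_ _)/andP[|_ /ltW //] c'.
    rewrite !inE => /orP[]/eqP ->; first exact: lt_trans b0b bt.
    by rewrite gt_max bt.
have /choice[n nP] (qc : bool * W) :
    exists e, qc.2 < e /\ exists2 x, at_pair p B J a b0 e x & V qc.1 x.
  exact: unb.
(* As [c] is closed under the heights found, a point at height [c] over [b0] is in the closure of
   both [V false] and [V true]. *)
have [c [x xc] cc] := sG _ Sb0
  (fun l => if l is [:: e] then Order.max (n (false, e)) (n (true, e)) else w0).
have meet q N : nbhs x N -> exists2 y, N y & V q y.
  move=> Nx; have w0c : w0 < c by apply: (cc [::]).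
  have [b1 [c1 [bb1 cc1 N1]]] := nbhs_at_pair hp xc Nx ab0 w0c.
  have [c1n [y yn Vy]] := nP (q, c1); exists y => //.
  apply: N1 yn => //; have := cc [:: c1].
  rewrite gt_max => /(_ _)/andP[e|]; first by rewrite inE => /eqP ->.
  by case: (q) => /ltW ? /ltW ?.
(* A value below 1/3 and one above 2/3 cannot both be within 1/6 of [f x]. *)
have e6 : (0 < 1/6 :> R)%R by lra.
have [y0 /= + y0V] := meet false _ (near_dist x fc e6).
have [y1 /= + y1V] := meet true _ (near_dist x fc e6).
move: y0V y1V; rewrite /V /= !ltr_norml => ly gy /andP[gx1 lx1] /andP[gx0 lx0].
by clear - ly gy gx0 lx0 gx1 lx1; lra.
Qed.

(** Induction on the number of coordinates outside [B]. For points whose free coordinates lie in a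
    club, [J] collects those equal to the least one. Fixing their common value [b] leaves fewer free
    coordinates, and [stationary_diagonal] carries the stationary sections obtained over to the
    diagonal. *)
Lemma stationary_slice B a :
  (forall g, exists x, (forall i, i \in B -> p i x = a i) /\
     forall i, i \notin B -> closed_under g (p i x)) ->
  stationary [set c | exists x, forall i, p i x = if i \in B then a i else c].
Proof.
have [n] := ubnP #|~: B|; elim: n B a => // n IH B a Bn meets.
apply: contrapT => /existsNP[g0 ng0].
have nconst x c : closed_under g0 c -> (forall i, i \in B -> p i x = a i) ->
    (forall i, i \notin B -> p i x = c) -> False.
  move=> cc xB xnB; apply: ng0; exists c => //; exists x => i.
  by case: ifPn => [/xB|/xnB].
pose Q J g := exists x b, [/\ forall i, i \in B -> p i x = a i, closed_under g b,
  exists2 i, i \notin B & i \in J, exists2 i, i \notin B & i \notin J &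
  forall i, i \notin B -> if i \in J then p i x = b else
    b < p i x /\ closed_under g (p i x)].
(* One [J] serves all [g]: there are finitely many candidates, so counterexamples to each of them,
   together with [g0], have a common majorant. *)
have [J QJ] : exists J, forall g, Q J g.
  apply: contrapT => /forallNP nQ.
  have /choice[G GP] J : exists g, ~ Q J g by have /existsNP[g] := nQ J; exists g.
  have /choice[g gP] (l : seq W) : exists b, forall o : option {set 'I_k},
      (if o is Some J then G J l else g0 l) < b.
    exact: (@omega1_ub _ _ hW (option {set 'I_k})).
  have [x [xB xnB]] := meets g.
  have xnB0 i : i \notin B -> closed_under g0 (p i x).
    by move=> /xnB; apply: closed_underW => l; exact: ltW (gP l None).
  have [nB0|/existsNP[i1 /negP i1B]] := pselect (forall i, i \in B); last first.
  - have [|b [j0 [j0B <-]] bmin] :=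
        @omega1_min _ _ hW [set w | exists i, i \notin B /\ p i x = w].
      by exists (p i1 x), i1.
    pose J := [set i | p i x == p j0 x]%SET.
    apply: (GP J); exists x, (p j0 x).
    have GJ i : i \notin B -> closed_under (G J) (p i x).
      by move=> /xnB; apply: closed_underW => l; exact: ltW (gP l (Some J)).
    split=> //.
    + exact: GJ.
    + by exists j0; rewrite // inE.
    (* If [J] contained every free coordinate, [x] would be a diagonal point over the club of
       [g0]. *)
    + apply: contrapT => nJ; apply: (nconst x (p j0 x)) => // [|i iB].
        exact: xnB0.
      apply: contrapT => pij; apply: nJ; exists i => //.
      by rewrite inE; exact/eqP.
    + move=> i iB; rewrite inE; case: eqVneq => // pij; split; last exact: GJ.
      by rewrite lt_neqAle eq_sym pij; apply: bmin; exists i.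
  - have [c _ cc] := closed_under_unbounded hW g0 (g0 [::]).
    by apply: (nconst x c) => // i; rewrite nB0.
have [_ [_ [_ _ [j0 j0B j0J] [i0 i0B i0J] _]]] := QJ g0.
pose S := [set b | forall g, exists x, [/\ forall i, i \in B -> p i x = a i,
  forall i, i \notin B -> i \in J -> p i x = b &
  forall i, i \notin B -> i \notin J -> closed_under g (p i x)]].
have sS : stationary S.
  move=> g1; apply: contrapT => nS.
  have /choice[G GP] b : exists g, ~ S b ->
      ~ exists x, [/\ forall i, i \in B -> p i x = a i,
        forall i, i \notin B -> i \in J -> p i x = b &
        forall i, i \notin B -> i \notin J -> closed_under g (p i x)].
    have [Sb|/existsNP[g gP]] := pselect (S b); first by exists g0.
    by exists g.
  (* Using the head of the list as [b] is a diagonal intersection: ordinals above [b] closed under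
     [g] are closed under [G b]. *)
  pose g l := Order.max (g1 l) (if l is b :: l' then G b l' else g1 l).
  have [x [b [xB cb _ _ xnB]]] := QJ g.
  have g1b : closed_under g1 b.
    by apply: closed_underW cb => l; rewrite le_max lexx.
  have nSb : ~ S b by move=> Sb; apply: nS; exists b.
  apply: (GP b nSb); exists x; split=> // i iB iJ; have := xnB i iB.
    by rewrite iJ.
  rewrite (negPf iJ) => -[bx cx] l lx.
  have := cx (b :: l); rewrite gt_max => /(_ _)/andP[] // c.
  by rewrite inE => /orP[/eqP ->|/lx].
suff : stationary [set c | exists x, at_pair p B J a c c x].
  move=> /(_ g0)[c [x xc] cc]; apply: (nconst x c) => // i iB; rewrite xc.
    by rewrite iB.
  by rewrite (negPf iB) if_same.
apply: (stationary_diagonal j0J j0B i0J i0B sS) => b Sb.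
have {}IH := IH (B :|: J) (fun i => if i \in B then a i else b).
have -> : [set c | exists x, at_pair p B J a b c x] = [set c | exists x,
    forall i, p i x = if i \in B :|: J then if i \in B then a i else b else c].
  by apply/seteqP; split=> c [x xc]; exists x => i; rewrite xc inE;
    case: (i \in B).
apply: IH.
  rewrite -ltnS; apply: leq_trans Bn; rewrite ltnS; apply: proper_card.
  apply/properP; split; first by rewrite finset.setCS; exact: finset.subsetUl.
  by exists j0; rewrite !inE ?j0B // j0J orbT.
move=> g; have [x [xB xJ xnJ]] := Sb g; exists x; split=> i; rewrite inE.
  by case: ifPn => [/xB|/xJ].
by rewrite negb_or => /andP[iB iJ]; exact: xnJ.
Qed.

(** By induction on [s], a Urysohn function separates [K m] from the part of [Y] that the tail
    leaves uncovered; the part of [Y] where it is at most 1/2 is closed and covered by the tail. *)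
Lemma closed_cover_functions (I : eqType) (s : seq I) (K : I -> set X)
    (Y : set X) :
  (forall m, closed (K m)) -> closed Y ->
  (forall y, Y y -> exists2 m, m \in s & ~ K m y) ->
  exists f : I -> X -> R, [/\ forall m, continuous (f m),
    forall m x, (0 <= f m x)%R, forall m x, K m x -> f m x = 0%R &
    forall y, Y y -> exists2 m, m \in s & (1/2 < f m y)%R].
Proof.
move=> cK; elim: s Y => [|m s IH] Y cY YK.
  exists (fun _ _ => 0%R); split=> // [m|y /YK[]//]; exact: cst_continuous.
have cY' : closed (Y `&` \bigcap_(n in [set` s]) K n).
  by apply: closedI => //; apply: closed_bigI => n _; exact: cK.
have YK0 : K m `&` (Y `&` \bigcap_(n in [set` s]) K n) = set0.
  rewrite -subset0 => y [Ky [/YK[n]]]; rewrite inE => /orP[/eqP -> //|js] nK.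
  by move=> /(_ _ js).
have [f0 [f0c f00 f0K f01]] := normal_urysohn R nX (cK m) cY' YK0.
have [||f [fc fge fK fY]] := IH (Y `&` [set y | (f0 y <= 1/2)%R]).
- apply: closedI => //; apply: closed_nbhsC => x /= /negP; rewrite -ltNge => fx.
  have e0 : (0 < f0 x - 1/2)%R by lra.
  apply: filterS (near_dist x f0c e0) => y /=; rewrite ltr_norml => /andP[_ ?].
  by apply/negP; rewrite -ltNge; lra.
- move=> y [Yy f0y]; have [n] := YK _ Yy; rewrite inE => /orP[/eqP ->|js nK].
    move=> nKi; apply: contrapT => nj.
    have : (f0 y = 1)%R.
      apply: f01; split=> // n' js; apply: contrapT => nKj.
      by apply: nj; exists n'.
    by move: f0y => /=; lra.
  by exists n.
(* The index [m] may recur in the tail, hence the sum. *)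
exists (fun n x => if n == m then f n x + f0 x else f n x)%R; split.
- move=> n; case: eqVneq => [->|_]; last exact: fc.
  by move=> x; apply: continuousD; [exact: fc | exact: f0c].
- by move=> n x; case: ifP => // _; rewrite addr_ge0.
- move=> n x Kjx; case: eqVneq => [ji|_]; last exact: fK.
  by rewrite fK // f0K ?addr0 // -ji.
- move=> y Yy; have [fy|fy] := leP (f0 y) (1/2)%R.
    have [n js fj] := fY y (conj Yy fy); exists n; first by rewrite inE js orbT.
    by case: ifP => // _; have := f00 y; lra.
  exists m; first by rewrite inE eqxx.
  by rewrite eqxx; have := fge m y; lra.
Qed.

End normal_slices.

(** * The game *)

Section plays.
Context {X : topologicalType} (s : @strategyII X).
Implicit Types (U V : nat -> set (X * X)).

Fixpoint history U n : seq (set (X * X) * X) :=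
  if n is m.+1 then rcons (history U m) (U m, s (history U m) (U m)) else [::].

Definition play U n := s (history U n) (U n).

Lemma follows_play U : follows s U (play U).
Proof.
move=> n; rewrite {1}/play; congr (s _ _); elim: n => [//|n IH].
have -> : iota 0 n.+1 = rcons (iota 0 n) n by rewrite -addn1 iotaD cats1.
by rewrite map_rcons -IH.
Qed.

Lemma eq_play U V n : (forall m, (m <= n)%N -> U m = V m) -> play U n = play V n.
Proof.
move=> UV; rewrite /play (UV n) //; congr (s _ _).
elim: n UV => //= n IH UV; rewrite IH => [|m mn]; last exact/UV/leqW.
by rewrite UV.
Qed.

(** [V] takes over in inning [n0 + 1], whose answer is still constrained by [U n0]. *)
Definition resume U n0 V n := if (n <= n0)%N then U n else V (n - n0.+1)%N.

Lemma resumeE U n0 V m : resume U n0 V (n0.+1 + m) = V m.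
Proof. by rewrite /resume addSn leqNgt ltnS leq_addr /= -addSn addKn. Qed.

Lemma play_resume U n0 V n : (n <= n0)%N -> play (resume U n0 V) n = play U n.
Proof.
by move=> nn0; apply: eq_play => m mn; rewrite /resume (leq_trans mn nn0).
Qed.

Lemma resume_legal E U n0 V : playerI_legal E U -> playerI_legal E V ->
  V 0%N `<=` U n0 -> playerI_legal E (resume U n0 V).
Proof.
move=> lU lV VU n; rewrite /resume.
have [nn0|n0n] := leqP n n0; last first.
  by rewrite leqNgt (ltnW _) //= subSn //; exact: lV.
split; first by case: (lU n).
have [_|n0n] := leqP n.+1 n0; first by case: (lU n).
have -> : n = n0 by apply/eqP; rewrite eqn_leq nn0.
by rewrite subnn.
Qed.

End plays.

(** Minimise one coordinate after another, each among the members of [S] that do not exceed the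
    previous choice on [B]. *)
Lemma coordinates_minimal d (W : orderTopologicalType d) (k : nat)
    (hW : is_omega1 W) (S : set ('I_k -> W)) (B : {set 'I_k}) : S !=set0 ->
  exists2 a, S a & forall a', S a' -> (forall i, i \in B -> a' i <= a i) ->
    forall i, i \in B -> a' i = a i.
Proof.
move=> S0; suff [a Sa aP] : exists2 a, S a & forall a', S a' ->
    (forall i, i \in B -> a' i <= a i) ->
    forall i, i \in enum 'I_k -> i \in B -> a' i = a i.
  by exists a => // a' Sa' aa' i; apply: (aP a' Sa' aa' i); rewrite mem_enum.
elim: (enum 'I_k) => [|j l [a Sa aP]]; first by have [a Sa] := S0; exists a.
have [|w [a1 [Sa1 a1a a1j]] wmin] := omega1_min hW (S := [set w | exists a',
    [/\ S a', forall i, i \in B -> a' i <= a i & a' j = w]]).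
  by exists (a j), a.
exists a1 => // a' Sa' aa1 i.
have aa i' : i' \in B -> a' i' <= a i'.
  by move=> iB; exact: le_trans (aa1 _ iB) (a1a _ iB).
rewrite inE => /orP[/eqP -> jB|il iB].
  by apply/eqP; rewrite eq_le aa1 //= a1j; apply: wmin; exists a'.
by rewrite (aP a') // (aP a1).
Qed.

(** * Player I against a fixed strategy *)

Section game.
Context {d : Order.disp_t} {W : orderTopologicalType d} (hW : is_omega1 W).
Context (R : realType) {X : topologicalType} {k : nat} (p : 'I_k -> X -> W).
Hypothesis hp : initial_coordinates p.
Implicit Types (i : 'I_k) (j m n : nat) (x y : X) (B : {set 'I_k}) (a : 'I_k -> W).
Implicit Types (U V : nat -> set (X * X)) (c : nat -> W).

Local Notation E := (fine_uniformity R X).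

Let E_filter : Filter E := @fine_uniformity_filter R X.
Existing Instance E_filter.

Lemma fine_uniformity_forall (I : finType) (A : I -> set (X * X)) :
  (forall t, E (A t)) -> E [set q | forall t, A t q].
Proof. exact: (@filter_forall _ _ A E). Qed.

Lemma fine_uniformity_le i w : E [set q | (p i q.1 <= w) = (p i q.2 <= w)].
Proof.
apply: (@fine_uniformity_open_relation R X
  (fun x y => (p i x <= w) = (p i y <= w))) => // [x y z -> //|x].
have [xw|wx] := leP (p i x) w.
  by apply: filterS (nbhs_coord hp (nbhs_omega1_le hW xw)) => y /= ->.
apply: filterS (nbhs_coord hp (nbhs_omega1_gt wx)) => y /=.
by rewrite ltNge => /negPf ->.
Qed.

(** Every neighbourhood of an ordinal contains a clopen interval ending there, cut out by the
    entourages of [fine_uniformity_le]. *)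
Lemma fine_uniformity_coordinates : compatible_uniformity E.
Proof.
apply: fine_uniformity_compatible => x N /hp[V nV VN].
have [A EA AV] : exists2 A : 'I_k -> set (X * X), (forall i, E (A i)) &
    forall i y, A i (x, y) -> V i (p i y).
  suff /choice[A AP] : forall i, exists A, E A /\
      forall y, A (x, y) -> V i (p i y).
    by exists A => i; case: (AP i).
  move=> i; have [Vx|[w wx wV]] := nbhs_omega1P (nV i).
    exists [set q | (p i q.1 <= p i x) = (p i q.2 <= p i x)].
    split; first exact: fine_uniformity_le.
    by move=> y /=; rewrite lexx => /esym/Vx.
  exists ([set q | (p i q.1 <= p i x) = (p i q.2 <= p i x)] `&`
    [set q | (p i q.1 <= w) = (p i q.2 <= w)]).
  split; first by apply: filterI; exact: fine_uniformity_le.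
  move=> y [/=]; rewrite lexx => /esym yx.
  by rewrite leNgt wx /= => /esym/negbT; rewrite -ltNge => /wV; apply.
exists [set q | forall i, A i q]; first exact: fine_uniformity_forall.
by move=> y /xsectionP /= Ay; apply: VN => i; exact: AV.
Qed.

Section strategy.
Context (s : @strategyII X).

(** A position is encoded by an infinite legal sequence and an inning; the bound depends on the
    entourages up to [U n] only. *)
Definition bounded_at B a U n := playerI_legal E U /\
  forall y, U n (play s U n, y) -> forall i, i \in B -> p i y <= a i.

Lemma bounded_at_minimal : exists B a U n, [/\ bounded_at B a U n,
  forall B' a' U' n', bounded_at B' a' U' n' -> (#|B'| <= #|B|)%N &
  forall a' U' n', bounded_at B a' U' n' ->
    (forall i, i \in B -> a' i <= a i) -> forall i, i \in B -> a' i = a i].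
Proof.
pose P B := `[< exists a U n, bounded_at B a U n >].
have [w0 _] := omega1_ub hW (fun v : void => match v with end).
have P0 : P (finset.set0).
  apply/asboolP; exists (fun=> w0), (fun=> setT), 0%N; split=> [n|y _ i].
    by split=> //; exact: filterT.
  by rewrite finset.in_set0.
case: (@arg_maxnP _ _ P (fun B => #|B|) P0) => B /asboolP[a0 [U0 [n0 b0]]] Bmax.
have [|a [U [n b]] amin] := coordinates_minimal hW
    (S := [set a | exists U n, bounded_at B a U n]) B.
  by exists a0, U0, n0.
exists B, a, U, n; split=> // [B' a' U' n' b'|a' U' n' b'].
  by apply: Bmax; apply/asboolP; exists a', U', n'.
by apply: amin; exists U', n'.
Qed.

Section resumed.
Context (hs : winning_strategyII E s) (B : {set 'I_k}) (a : 'I_k -> W).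
Context (U0 : nat -> set (X * X)) (n0 : nat).
Hypothesis Bmax :
  forall B' a' U' n', bounded_at B' a' U' n' -> (#|B'| <= #|B|)%N.
Hypothesis amin : forall a' U' n', bounded_at B a' U' n' ->
  (forall i, i \in B -> a' i <= a i) -> forall i, i \in B -> a' i = a i.
Hypothesis Bbound : bounded_at B a U0 n0.

(* U_n constrains only x_(n+1), so an answer below c j in some coordinate traps
   the following ones only if the separation at c j was played beforehand. *)
Definition resumption (A : set (X * X)) c m := U0 n0 `&`
  [set q | forall i, i \in B -> (p i q.1 <= a i) = (p i q.2 <= a i)] `&` A `&`
  [set q | forall j, (j < m)%N -> forall i, (p i q.1 <= c j) = (p i q.2 <= c j)].

(** Answers are renumbered from inning [n0 + 1], so that answer [m + 1] is constrained by
    [resumption A c m]. *)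
Definition position A c m := play s (resume U0 n0 (resumption A c)) (n0.+1 + m).

Lemma resumption_legal A c : E A -> playerI_legal E (resumption A c).
Proof.
move=> EA m; split.
  apply: filterI.
    apply: filterI => //; apply: filterI; first by case: (Bbound.1 n0).
    apply: fine_uniformity_forall => i; case: (boolP (i \in B)) => [_|niB].
      by apply: filterS (fine_uniformity_le i (a i)) => q.
    by apply: filterS filterT => q _.
  elim: m => [|m IH]; first by apply: filterS filterT => q _ j.
  have Em : E [set q | forall i, (p i q.1 <= c m) = (p i q.2 <= c m)].
    by apply: fine_uniformity_forall => i; exact: fine_uniformity_le.
  apply: filterS (filterI IH Em) => q [qm qc] j; rewrite ltnS leq_eqVlt.
  by move=> /orP[/eqP ->|/qm].
by move=> q [[[? ?] ?] qm]; split=> // j jm; apply: qm; exact: leqW.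
Qed.

Lemma resume_resumption_legal A c : E A ->
  playerI_legal E (resume U0 n0 (resumption A c)).
Proof.
move=> EA; apply: resume_legal; first by case: Bbound.
  exact: resumption_legal.
by move=> q [[[]]].
Qed.

Lemma position_legal A c m : E A ->
  resumption A c m (position A c m, position A c m.+1).
Proof.
move=> EA; have lU := resume_resumption_legal c EA.
have [+ _] := hs lU (follows_play s _).
by move=> /(_ (n0.+1 + m)%N)/xsectionP; rewrite resumeE -addnS.
Qed.

(** [U0 n0] confines the first answer, and the clause on [a] in [resumption] passes the bound on. *)
Lemma position_le A c m i : E A -> i \in B -> p i (position A c m) <= a i.
Proof.
move=> EA; elim: m i => [|m IH] i iB.
  have [_ bnd] := Bbound; apply: bnd iB.
  have [+ _] := hs (resume_resumption_legal c EA) (follows_play s _).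
  move=> /(_ n0)/xsectionP; rewrite play_resume // {1}/resume leqnn.
  by rewrite /position addn0.
have [[[_ /(_ i iB) /= <-] _] _] := position_legal c m EA.
exact: IH.
Qed.

Lemma bounded_at_position A c m a' B' : E A ->
  (forall y, resumption A c m (position A c m, y) ->
     forall i, i \in B' -> p i y <= a' i) ->
  bounded_at B' a' (resume U0 n0 (resumption A c)) (n0.+1 + m).
Proof.
move=> EA bnd; split; first exact: resume_resumption_legal.
by move=> y; rewrite resumeE; exact: bnd.
Qed.

Lemma resumption_le A c m y i : E A -> resumption A c m (position A c m, y) ->
  i \in B -> p i y <= a i.
Proof.
move=> EA [[[_ /(_ i) /= + _] _]] iB => /(_ iB) <-.
exact: position_le.
Qed.

(** A bound would confine [i |: B], against the maximality of [B]. *)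
Lemma position_unbounded A c m i w : E A -> i \notin B ->
  ~ forall y, resumption A c m (position A c m, y) -> p i y <= w.
Proof.
move=> EA iB bnd.
have : bounded_at (i |: B) (fun i' => if i' == i then w else a i')
    (resume U0 n0 (resumption A c)) (n0.+1 + m).
  apply: bounded_at_position => // y yr j.
  rewrite in_setU1; case: eqVneq => [-> _|_ /= jB]; first exact: bnd.
  exact: resumption_le yr jB.
by move=> /Bmax; rewrite cardsU1 iB ltnn.
Qed.

Lemma position_unbounded_lt A c m i w : E A -> i \in B -> w < a i ->
  ~ forall y, resumption A c m (position A c m, y) -> p i y <= w.
Proof.
move=> EA iB wa bnd.
have : bounded_at B (fun i' => if i' == i then w else a i')
    (resume U0 n0 (resumption A c)) (n0.+1 + m).
  apply: bounded_at_position => // y yr j jB.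
  case: eqVneq => [->|_]; first exact: bnd.
  exact: resumption_le yr jB.
move=> /amin h; have := h _ i iB; rewrite eqxx => h'.
have /h' wE : forall i', i' \in B -> (if i' == i then w else a i') <= a i'.
  by move=> j _; case: eqVneq => [->|//]; exact: ltW.
by move: wa; rewrite wE ltxx.
Qed.

(** For [j < m] the separation at [c j] is in force, so an answer at or below [c j] would confine
    coordinate [i] to that bound. *)
Lemma position_gt A c m j i : E A -> (j < m)%N -> (i \in B -> c j < a i) ->
  c j < p i (position A c m).
Proof.
move=> EA jm ca; rewrite ltNge; apply/negP => le.
have bnd y : resumption A c m (position A c m, y) -> p i y <= c j.
  by move=> [_ /(_ j jm i) /= <-].
have [iB|iB] := boolP (i \in B).
  exact: (position_unbounded_lt EA iB (ca iB) bnd).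
exact: (position_unbounded EA iB bnd).
Qed.

(** An answer is thus a function of the finite list of earlier separation points, the form that
    [closed_under] can handle. *)
Lemma eq_position A c c' m : (forall j, (j < m)%N -> c j = c' j) ->
  position A c m = position A c' m.
Proof.
move=> cc'; apply: eq_play => n nm; rewrite /resume; case: ifP => // n0n.
rewrite /resumption; congr (_ `&` _); apply/seteqP.
have lt j : (j < n - n0.+1)%N -> c j = c' j.
  by move=> jn; apply: cc'; apply: leq_trans jn _; rewrite leq_subLR.
by split=> q qc j jn i; have := qc j jn i; rewrite lt.
Qed.

(** Player I separates at all ordinals below [w] in turn. Closure under [g] keeps the answers below
    [w] off [B], and the separations push every coordinate up to that of [x]. *)
Lemma resumed_convergence w g : (exists x, forall i,
    p i x = if i \in B then a i else w) ->
  closed_under g w -> (forall i, a i < g [::]) ->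
  (forall l i, p i (position setT (nth (g [::]) l) (size l)) < g l) ->
  False.
Proof.
move=> [x xw] cw ga gl.
have g0w : g [::] < w by exact: cw.
have [c cw' cE] := omega1_enum hW g0w.
pose U := resume U0 n0 (resumption setT c).
have lU : playerI_legal E U by apply: resume_resumption_legal; exact: filterT.
have ET : E setT by exact: filterT.
have [_] := hs lU (follows_play s _); apply; right; exists x.
move=> N /hp[V nV VN].
have Vi i : \forall m \near \oo, V i (p i (position setT c m)).
  suff : (fun m => p i (position setT c m)) @ \oo --> p i x.
    by move=> /(_ _ (nV i)).
  apply: (cvg_omega1) => [m|v vx].
    rewrite xw; case: ifPn => iB; first exact: position_le.
    rewrite (@eq_position _ c (nth (g [::]) (mkseq c m))) => [|j jm].
      apply/ltW; have := gl (mkseq c m) i; rewrite size_mkseq => /lt_trans.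
      apply; apply: cw => v /mapP[j _ ->]; exact: cw'.
    by rewrite nth_mkseq.
  have [j vE] : exists j, c j = v.
    apply: cE; move: vx; rewrite xw; case: ifP => // iB /lt_trans; apply.
    exact: lt_trans (ga i) g0w.
  exists j.+1 => // m /= jm; rewrite -vE; apply: position_gt => // iB.
  by move: vx; rewrite xw iB vE.
have [M _ MV] := @filter_forall _ _ _ _ _ Vi.
exists (n0.+1 + M)%N => // n /= Mn; apply: VN => i.
have -> : n = (n0.+1 + (n - n0.+1))%N.
  by rewrite subnKC // (leq_trans _ Mn) // leq_addr.
by apply: MV; rewrite /= leq_subRL // (leq_trans _ Mn) // leq_addr.
Qed.

Lemma resumed_empty_intersection g : normal_space X ->
  (forall x, (forall i, i \in B -> p i x = a i) ->
     exists2 i, i \notin B & ~ closed_under g (p i x)) -> False.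
Proof.
move=> nX ng.
pose K i := [set x | closed_under g (p i x)].
pose Y := [set x | forall i, i \in B -> p i x = a i].
have cK i : closed (K i).
  apply: closed_nbhsC => x nK; apply: (nbhs_coord hp (N := [set v | ~ closed_under g v])).
  by apply: filterS (nbhs_not_closed_under hW nK) => y [].
have cY : closed Y.
  apply: closed_nbhsC => x /existsNP[i /not_implyP[iB nxi]].
  by apply: filterS (nbhs_coord_neq_cst hW hp nxi) => y ny /(_ i iB).
have YK y : Y y -> exists2 i, i \in enum (~: B)%SET & ~ K i y.
  by move=> /ng[i iB nK]; exists i; rewrite // mem_enum inE.
have [f [fc f0 fK fY]] := closed_cover_functions R nX cK cY YK.
pose e i x y := forall v, closed_under g v -> (p i x <= v) = (p i y <= v).
(* If [f i y] exceeds 1/2 for a common point [y], then [f i] exceeds 1/4, hence 1/8, at the answer,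
   and the gap clause applies there. *)
pose A := [set q | forall i, (`|f i q.1 - f i q.2| < 1/4)%R /\
                             ((1/8 <= f i q.1)%R -> e i q.1 q.2)].
have EA : E A.
  apply: fine_uniformity_forall => i; apply: filterI.
    by apply: fine_uniformity_continuous => //; lra.
  apply: fine_uniformity_hedgehog => //; last by lra.
  - by move=> x y exy v cv; rewrite exy.
  - by move=> x y z exy eyz v cv; rewrite exy // eyz.
  - move=> x fx; have nK : ~ closed_under g (p i x).
      by move=> cx; move: fx; rewrite fK // ltxx.
    have := nbhs_coord hp (nbhs_not_closed_under hW nK).
    by apply: filterS => y [].
have [b bP] := omega1_ub hW (fun o : option 'I_k =>
  if o is Some i then a i else g [::]).
have [c _ cE] := omega1_enum hW (bP None).
pose U := resume U0 n0 (resumption A c).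
have lU : playerI_legal E U by exact: resume_resumption_legal.
have [_] := hs lU (follows_play s _); apply; left.
rewrite -subset0 => y yU.
have yr m : resumption A c m (position A c m, y).
  by have /xsectionP := yU (n0.+1 + m)%N I; rewrite /U resumeE.
(* If [p i y < a i], then [p i y] is some [c j]; answer [j + 1] exceeds it, and [y] lies on the same
   side of [c j] as that answer. *)
have Yy : Y y.
  move=> i iB; apply/eqP; rewrite eq_le (resumption_le EA (yr 0%N) iB) /=.
  rewrite leNgt; apply/negP => ya.
  have [j cj] : exists j, c j = p i y by apply: cE; exact: lt_trans (bP (Some i)).
  have := @position_gt A c j.+1 j i EA (ltnSn j); rewrite cj => /(_ (fun=> ya)).
  have [_ /(_ j (ltnSn j) i) /=] := yr j.+1.
  by rewrite cj lexx leNgt => /negbTE ->.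
have [i] := fY _ Yy; rewrite mem_enum inE => iB fy.
have [[_ /(_ i) /= [fxy _]] _] := yr 0%N.
have fx : (1/8 <= f i (position A c 0))%R.
  by move: fxy; rewrite ltr_norml => /andP[+ _]; move: fy; clear; lra.
(* The gap clause bounds coordinate [i] of every legal reply by [v]. *)
have [v vx cv] := closed_under_unbounded hW g (p i (position A c 0)).
apply: (@position_unbounded A c 0 i v EA iB) => z.
move=> [[_ /(_ i) [_ /(_ fx) /(_ v cv) /= xz]] _].
by rewrite -xz ltW.
Qed.

End resumed.

Lemma no_winning_strategy : normal_space X -> ~ winning_strategyII E s.
Proof.
move=> nX hs.
have [B [a [U0 [n0 [Bbound Bmax amin]]]]] := bounded_at_minimal.
have [g0 g0a] := omega1_fin_ub hW a.
(* [g] bounds the answers to each finite list of separations, and [None] adds [g0], which exceeds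
   all [a i]. *)
have /choice[g gP] (l : seq W) : exists b, forall o : option 'I_k,
    (if o is Some i then
       Order.max g0 (p i (position B a U0 n0 setT (nth g0 l) (size l)))
     else g0) < b.
  exact: (@omega1_ub _ _ hW (option 'I_k)).
have [[w xw cw]|nT] := pselect (exists2 w, (exists x, forall i,
    p i x = if i \in B then a i else w) & closed_under g w).
  apply: (resumed_convergence hs Bmax amin Bbound xw cw) => [i|l i].
    exact: lt_trans (g0a i) (gP [::] None).
  have := gP l (Some i); rewrite gt_max => /andP[_]; congr (p i _ < _).
  apply: eq_position => j jl; exact: set_nth_default.
suff [g' g'P] : exists g', forall x, (forall i, i \in B -> p i x = a i) ->
    exists2 i, i \notin B & ~ closed_under g' (p i x).
  exact: (resumed_empty_intersection hs Bmax amin Bbound nX g'P).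
(* If every club contained all free coordinates of some point of the slice, [stationary_slice] would
   produce the excluded diagonal point. *)
apply: contrapT => /forallNP ng; apply: nT.
apply: (stationary_slice hW R hp nX) => g'.
have /existsNP[x /not_implyP[xB nx]] := ng g'; exists x; split=> // i iB.
by apply: contrapT => nc; apply: nx; exists i.
Qed.

End strategy.
End game.

(** * Neighbourhoods in subspaces of finite powers *)

Lemma nbhs_prod_topology (T : topologicalType) (I : finType)
    (z : prod_topology (fun _ : I => T)) (N : set (prod_topology (fun _ : I => T))) :
  nbhs z N -> exists2 V : I -> set T, forall i, nbhs (z i) (V i) &
    forall y, (forall i, V i (y i)) -> N y.
Proof.
pose F := filter_from [set V : I -> set T | forall i, nbhs (z i) (V i)]
  (fun V => [set y : prod_topology (fun _ : I => T) | forall i, V i (y i)]).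
have FF : Filter F.
  apply: filter_from_filter => [|V V' nV nV'].
    by exists (fun=> setT) => i; exact: filterT.
  exists (fun i => V i `&` V' i) => [i|y Vy]; first exact: filterI.
  by split=> i; case: (Vy i).
(* The box filter converges in each coordinate, hence in the product. *)
have Fz : F --> z.
  apply/cvg_sup => i; apply/cvg_image.
    by rewrite eqEsubset; split=> // t _; exists (fun=> t).
  move=> B nB; exists (proj i @^-1` B); last first.
    by apply: image_preimage; rewrite eqEsubset; split=> // t _; exists (fun=> t).
  exists (fun j => if j == i then B else setT) => [j|y /(_ i)].
    by case: eqVneq => [->//|_]; exact: filterT.
  by rewrite eqxx.
by move=> /Fz[V nV VN]; exists V.
Qed.

Lemma initial_coordinates_subspace d (W : orderTopologicalType d) (k : nat)
    (A : set (prod_topology (fun _ : 'I_k => W))) :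
  initial_coordinates (fun i (x : set_type A) => (\val x) i).
Proof.
move=> x N; split=> [[_ [[M oM <-] Mx MN]]|[V nV VN]].
  have nM : nbhs (\val x : prod_topology (fun _ : 'I_k => W)) M.
    exact: open_nbhs_nbhs.
  have [V nV VM] := nbhs_prod_topology nM.
  by exists V => // y Vy; apply: MN; exact: VM.
have nV' i : nbhs x [set y : set_type A | V i ((\val y) i)].
  have pc : continuous (fun y : set_type A => (\val y) i).
    move=> y; apply: (@continuous_comp _ _ _ (\val : set_type A -> _) (proj i)).
      exact: initial_continuous.
    exact: proj_continuous.
  exact: (pc x _ (nV i)).
apply: filterS (@filter_forall _ _ _ _ _ nV') => y Vy; exact: VN.
Qed.

Theorem theorem3 (d : Order.disp_t) (W : orderTopologicalType d)
    (hW : is_omega1 W) (k : nat) (hk : (0 < k)%N)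
    (A : set (prod_topology (fun _ : 'I_k => W)))
    (hA : @normal_space (set_type A)) :
  semi_proximal (set_type A).
Proof.
have hp := @initial_coordinates_subspace d W k A.
exists (fine_uniformity Rdefinitions.R (set_type A)).
  exact: fine_uniformity_coordinates hp.
by move=> [s]; exact: no_winning_strategy hp s hA.
Qed.
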